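(* Let $p$ be a prime, let $0<q_{\min}\le q_{\max}<1$ be constants and $\delta\in(0,1)$. Take the auxiliary distributions so that, given disjoint $M,W\subseteq[n]$ (with query set $M\cup W$), the query vector $\boldsymbol{v}\in\mathbb{F}_p^n$ has $v_i=0$ for $i\notin M\cup W$ and $v_i$ independent and uniform in $\mathbb{F}_p$ for $i\in M\cup W$ (so some such entries may be $0$). Then for every sketching matrix $A\in\mathbb{F}_p^{k\times n}$ there is a $\delta$-determining pool $L\subseteq[n]$ of size $O(k\log(k/\delta))$.
   Context: Linear sketch setting: ground set $[n]$; a query consists of a set $U\cup M\subseteq[n]$ together with auxiliary information $X$ specifying the entries of a vector $\boldsymbol{v}$; the sketch is $S=A\boldsymbol{v}\in\mathbb{F}_p^k$. For $M\subseteq[n]$ and $U\subseteq[n]$, let $\mathcal{D}(M,U\setminus M)$ be the distribution of the sketch $A\boldsymbol{v}$ when $\boldsymbol{v}$ is sampled from the auxiliary distribution with mask $M$ and $W=U\setminus M$. A set $L\subseteq[n]$ is a $\delta$-determining pool if there are distributions $\mathcal{D}'(M,W)$ for all $M\subseteq L$, $W\subseteq L\setminus M$ such that for all $M\subseteq L$ and $q\in[q_{\min},q_{\max}]$, $\mathbb{E}_{U\sim\mathrm{Bern}[q]^{[n]}}\|\mathcal{D}(M,U\setminus M)-\mathcal{D}'(M,U\cap(L\setminus M))\|_{TV}\le\delta$, where $\mathrm{Bern}[q]^{[n]}$ includes each index independently with probability $q$. The implied constant in $O(\cdot)$ may depend on $q_{\min}$. *)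

(* Defs.v *)
From HB Require Import structures.
From mathcomp Require Import all_boot all_order all_algebra.
From mathcomp Require Import reals exp.

Set Implicit Arguments.
Unset Strict Implicit.
Unset Printing Implicit Defensive.

Import Order.TTheory GRing.Theory Num.Theory.
Local Open Scope ring_scope.

Record fdist (R : realType) (T : finType) := FDist {
  pmf :> T -> R;
  pmf_ge0 : forall x, 0 <= pmf x;
  pmf_sum1 : \sum_x pmf x = 1 }.

Section Distributions.
Context {R : realType}.

Lemma dirac_ge0 (T : finType) (a x : T) : 0 <= (x == a)%:R :> R.
Proof. exact: ler0n. Qed.

Lemma dirac_sum1 (T : finType) (a : T) : \sum_x (x == a)%:R = 1 :> R.
Proof.
by rewrite (bigD1 a) //= eqxx big1 ?addr0 // => x /negbTE ->.
Qed.

Definition dirac_dist (T : finType) (a : T) : fdist R T :=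
  FDist (dirac_ge0 a) (dirac_sum1 a).

Section Uniform.
(* [a] only witnesses that [T] is inhabited. *)
Variables (T : finType) (a : T).

Lemma unif_ge0 (x : T) : 0 <= #|T|%:R^-1 :> R.
Proof. by rewrite invr_ge0 ler0n. Qed.

Lemma unif_sum1 : \sum_(x : T) #|T|%:R^-1 = 1 :> R.
Proof.
rewrite sumr_const -[X in X = _]mulr_natr mulVf // pnatr_eq0 -lt0n.
by apply/card_gt0P; exists a.
Qed.

Definition unif_dist : fdist R T := FDist unif_ge0 unif_sum1.
End Uniform.

Section Pushforward.
Variables (T T' : finType) (f : T -> T') (P : fdist R T).

Lemma push_ge0 (y : T') : 0 <= \sum_(x | f x == y) P x.
Proof. by apply: sumr_ge0 => x _; exact: pmf_ge0. Qed.

Lemma push_sum1 : \sum_y \sum_(x | f x == y) P x = 1.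
Proof.
rewrite -(pmf_sum1 P) [RHS](partition_big f predT) //=.
Qed.

Definition push_dist : fdist R T' := FDist push_ge0 push_sum1.
End Pushforward.

Section Product.
Variables (I T : finType) (P : I -> fdist R T).

Lemma prod_ge0 (f : {ffun I -> T}) : 0 <= \prod_i P i (f i).
Proof. by apply: prodr_ge0 => i _; exact: pmf_ge0. Qed.

Lemma prod_sum1 : \sum_(f : {ffun I -> T}) \prod_i P i (f i) = 1.
Proof.
by rewrite -(bigA_distr_bigA (fun i => P i)) big1 // => i _; exact: pmf_sum1.
Qed.

(* Law of a family of independent variables, the [i]-th one with law [P i]. *)
Definition prod_dist : fdist R {ffun I -> T} := FDist prod_ge0 prod_sum1.
End Product.

Definition tv_dist (T : finType) (P Q : fdist R T) : R :=
  2^-1 * \sum_x `|P x - Q x|.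

(* Expectation of [F U] where [U] contains each [i] independently with
   probability [q]; meaningful for [0 <= q <= 1]. *)
Definition bern_expect (n : nat) (q : R) (F : {set 'I_n} -> R) : R :=
  \sum_(U : {set 'I_n}) (\prod_i (if i \in U then q else 1 - q)) * F U.

End Distributions.

Section Sketch.
Variables (R : realType) (p k n : nat).

(* For each mask [M] and each [W] (disjoint from [M]), the law of the query
   vector; the query set is [M :|: W]. *)
Definition aux_family :=
  {set 'I_n} -> {set 'I_n} -> fdist R 'cV['F_p]_n.

Definition unif_aux : aux_family := fun M W =>
  push_dist (fun f : {ffun 'I_n -> 'F_p} => \col_i f i)
    (prod_dist (fun i => if i \in M :|: W then unif_dist (0 : 'F_p)
                         else dirac_dist (0 : 'F_p))).

Definition sketch_dist (A : 'M['F_p]_(k, n)) (aux : aux_family)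
    (M W : {set 'I_n}) : fdist R 'cV['F_p]_k :=
  push_dist (fun v : 'cV['F_p]_n => A *m v) (aux M W).

(* [D'] is a total function, but only its values at [M \subset L] and
   [W \subset L :\: M] are used. *)
Definition determining_pool (A : 'M['F_p]_(k, n)) (aux : aux_family)
    (qmin qmax delta : R) (L : {set 'I_n}) : Prop :=
  exists D' : {set 'I_n} -> {set 'I_n} -> fdist R 'cV['F_p]_k,
    forall (M : {set 'I_n}) (q : R), M \subset L -> qmin <= q <= qmax ->
      bern_expect q (fun U =>
        tv_dist (sketch_dist A aux M (U :\: M)) (D' M (U :&: (L :\: M))))
      <= delta.

End Sketch.

Arguments unif_aux R p n : clear implicits.

(* Main.v *)
Require Import Defs.
From HB Require Import structures.
From mathcomp Require Import all_boot all_order all_algebra.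
From mathcomp Require Import reals exp.
From mathcomp Require Import lra ring.

Set Implicit Arguments.
Unset Strict Implicit.
Unset Printing Implicit Defensive.

Import Order.TTheory GRing.Theory Num.Theory.
Local Open Scope ring_scope.

(** Let [r X] be the rank of the columns of [A] indexed by [X]; the sketch of a
query set [X] is uniform on the span of these columns. Build [L] by [t] times
moving a basis of the remaining columns into it, so [#|L| <= k * t]. By
submodularity of [r], sampling a spanning set of a space with probability [q]
shrinks the expected codimension of the sampled span by a factor [1 - q], so the
expected codimension of the span of [U] in the span of [U :|: ~: L] is at most
[(1 - q) ^+ t.+1 * k]: one factor for each basis in [L], one for [~: L]. When
that codimension is [0], sketching [M :|: U] or [M :|: U :|: ~: L] gives the same
law, and the latter depends only on [M] and [U :&: (L :\: M)]. *)

(** * Expectation over a Bernoulli random subset *)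

Section BernExpect.
Variables (R : realType) (n : nat) (q : R).
Implicit Types (F G : {set 'I_n} -> R) (U V : {set 'I_n}) (b : 'I_n).

Lemma eq_bern_expect F G : F =1 G -> bern_expect q F = bern_expect q G.
Proof. by move=> FG; apply: eq_bigr => U _; rewrite FG. Qed.

Lemma bern_expectD F G :
  bern_expect q (fun U => F U + G U) = bern_expect q F + bern_expect q G.
Proof. by rewrite -big_split; apply: eq_bigr => U _; rewrite mulrDr. Qed.

Lemma bern_expectZ a F : bern_expect q (fun U => a * F U) = a * bern_expect q F.
Proof. by rewrite mulr_sumr; apply: eq_bigr => U _; rewrite mulrCA. Qed.

Lemma bern_expectB F G :
  bern_expect q (fun U => F U - G U) = bern_expect q F - bern_expect q G.
Proof.
rewrite -[- bern_expect q G]mulN1r -bern_expectZ -bern_expectD.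
by apply: eq_bern_expect => U; rewrite mulN1r.
Qed.

Lemma bern_expect_cst a : bern_expect q (fun _ : {set 'I_n} => a) = a :> R.
Proof.
rewrite /bern_expect -mulr_suml.
rewrite -(bigA_distr _ _ (fun=> q) (fun=> 1 - q)).
by rewrite big1 ?mul1r // => i _; rewrite /= addrC subrK.
Qed.

Lemma bern_expect_cond b F :
  bern_expect q F = \sum_(V : {set 'I_n} | b \notin V)
    (\prod_(i | i != b) (if i \in V then q else 1 - q)) *
    (q * F (b |: V) + (1 - q) * F V).
Proof.
rewrite /bern_expect (bigID (fun V : {set 'I_n} => b \in V)) /=.
rewrite (reindex_onto (fun V => b |: V) (fun V => V :\ b)) /=; last first.
  by move=> V bV; rewrite setD1K.
rewrite (eq_bigl (fun V : {set 'I_n} => b \notin V)); last first.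
  move=> V; rewrite setU11 /=; apply/eqP/idP => [<-|bV]; first by rewrite setD11.
  by rewrite setU1K.
rewrite -big_split; apply: eq_bigr => V bV /=.
rewrite (bigD1 b) //= setU11 [X in _ + X * _](bigD1 b) //= (negbTE bV).
rewrite (eq_bigr (fun i => if i \in V then q else 1 - q)); last first.
  by move=> i ib; rewrite !inE (negbTE ib).
by rewrite mulrDr !mulrA ![_ * \prod_(i | _) _]mulrC.
Qed.

(** Membership of [b] is independent of the rest of [U], so it can be averaged out while [U] remains
    the sample. *)
Lemma bern_expect_resample b F :
  bern_expect q F =
  bern_expect q (fun U => q * F (b |: U) + (1 - q) * F (U :\ b)).
Proof.
rewrite (bern_expect_cond b F) (bern_expect_cond b (fun U => _ + _)).
apply: eq_bigr => V bV; congr (_ * _).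
rewrite setUA setUid setU1K // (setDidPl _); last by rewrite disjoint_sym disjoints1.
by ring.
Qed.

Hypothesis q01 : 0 <= q <= 1.

Lemma ler_bern_expect F G :
  (forall U, F U <= G U) -> bern_expect q F <= bern_expect q G.
Proof.
move=> FG; apply: ler_sum => U _; apply: ler_wpM2l (FG U).
by apply: prodr_ge0 => i _; case: ifP => _; [case/andP: q01 | rewrite subr_ge0; case/andP: q01].
Qed.

End BernExpect.

(** * Monotone submodular functions under sampling *)

Definition submodular (n : nat) (f : {set 'I_n} -> nat) :=
  forall X Y, (f (X :|: Y) + f (X :&: Y) <= f X + f Y)%N.

Definition set_monotone (n : nat) (f : {set 'I_n} -> nat) :=
  forall X Y : {set 'I_n}, X \subset Y -> (f X <= f Y)%N.

Section Submodular.
Variables (n : nat) (f : {set 'I_n} -> nat).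
Implicit Types B L S U X Y Z : {set 'I_n}.
Hypotheses (fM : set_monotone f) (fS : submodular f).

(** Diminishing returns, stated additively on [nat]: the intersection of [S :|: B] and [X] contains
    [B]. *)
Lemma submodular_exchange S B X : B \subset X ->
  (f (S :|: X) + f B <= f (S :|: B) + f X)%N.
Proof.
move=> BX; apply: leq_trans (fS (S :|: B) X).
rewrite -setUA (setUidPr BX) leq_add2l; apply: fM.
by rewrite subsetI BX subsetUr.
Qed.

Lemma submodular_span S B X : B \subset X -> f B = f X ->
  f (S :|: B) = f (S :|: X).
Proof.
move=> BX fBX; apply/eqP; rewrite eqn_leq fM ?setUS //=.
by have := submodular_exchange S BX; rewrite fBX leq_add2r.
Qed.

(** Take [B] maximal in [X] with [#|B| <= f B]. An element of [X] raising [f] could join [B], so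
    none does, and by exchange neither does all of [X]. *)
Lemma submodular_basis X :
  exists B : {set 'I_n}, [/\ B \subset X, (#|B| <= f B)%N & f B = f X].
Proof.
pose P B := (B \subset X) && (#|B| <= f B)%N.
have P0 : P set0 by rewrite /P sub0set cards0.
case: (maxset_exists P0) => B /maxsetP[/andP[BX cB] maxB] _.
exists B; split=> //.
have sat x : x \in X -> f (x |: B) = f B.
  move=> xX; apply/eqP; rewrite eqn_leq [X in _ && X]fM ?subsetUr // andbT leqNgt.
  apply/negP => lt_f.
  have xB : x \in B.
    rewrite -(maxB (x |: B)) ?setU11 ?subsetUr // /P subUset sub1set xX BX /=.
    by rewrite (leq_trans _ lt_f) // cardsU1 -add1n leq_add // leq_b1.
  by move: lt_f; rewrite (setUidPr _) ?sub1set // ltnn.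
have span s : all (mem X) s -> f ([set:: s] :|: B) = f B.
  elim: s => [_|x s IHs /= /andP[xX /IHs fs]]; first by rewrite set_nil set0U.
  rewrite set_cons; apply/eqP; rewrite eqn_leq [X in _ && X]fM ?subsetUr // andbT.
  have := submodular_exchange [set x] (subsetUr [set:: s] B).
  by rewrite setUA fs sat // leq_add2r.
rewrite -(span (enum X)); last by apply/allP => x; rewrite mem_enum.
by rewrite set_enum (setUidPl BX).
Qed.

(** Sampling [B] realises on average at least the share [q] of its full gain, because marginal gains
    shrink as the set grows. *)
Lemma bern_expect_submodular (R : realType) (q : R) T Z B :
    0 <= q <= 1 -> [disjoint Z & B] ->
  q * bern_expect q (fun U => (f (T :|: (U :&: Z) :|: B))%:R)
    + (1 - q) * bern_expect q (fun U => (f (T :|: (U :&: Z)))%:R)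
  <= bern_expect q (fun U => (f (T :|: (U :&: (Z :|: B))))%:R) :> R.
Proof.
move=> q01; move: {2}#|B| (erefl #|B|) => m.
(* [T] stays general: the induction hypothesis is used at [T] when [b] is left out and at [b |: T]
   when it is sampled. *)
elim: m B T => [|m IHm] B T cB ZB.
  move/eqP: cB; rewrite cards_eq0 => /eqP ->; rewrite setU0.
  under eq_bern_expect do rewrite setU0.
  by rewrite -mulrDl addrC subrK mul1r.
have [b bB] : exists b, b \in B by apply/card_gt0P; rewrite cB.
have bZ : b \notin Z by rewrite (disjointFl ZB).
pose B' := B :\ b.
have cB' : #|B'| = m by move: cB; rewrite (cardsD1 b) bB => -[].
have ZB' : [disjoint Z & B'] by rewrite (disjointWr _ ZB) ?subD1set.
have bY : b \notin Z :|: B' by rewrite !inE negb_or bZ eqxx.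
have BE : B = b |: B' by rewrite setD1K.
have -> : Z :|: B = b |: (Z :|: B') by rewrite BE setUCA.
pose E (G : {set 'I_n} -> {set 'I_n}) : R := bern_expect q (fun U => (f (G U))%:R).
pose P U := T :|: U :&: Z.
have IH0 : q * E (fun U => P U :|: B') + (1 - q) * E P
    <= E (fun U => T :|: U :&: (Z :|: B')) := IHm B' T cB' ZB'.
have IH1 : q * E (fun U => P U :|: B) + (1 - q) * E (fun U => b |: P U)
    <= E (fun U => b |: T :|: U :&: (Z :|: B')).
  apply: le_trans (IHm B' (b |: T) cB' ZB'); rewrite le_eqVlt; apply/orP; left; apply/eqP.
  congr (_ * _ + _ * _).
    apply: eq_bern_expect => U; congr (f _)%:R.
    by rewrite BE /P setUCA !setUA.
  by apply: eq_bern_expect => U; rewrite /P setUA.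
(* Submodularity trades the cross terms of [IH1] and [IH0], both of weight [q * (1 - q)], for the
   two terms wanted. *)
have sub : E (fun U => P U :|: B) + E P
    <= E (fun U => P U :|: B') + E (fun U => b |: P U).
  rewrite -!bern_expectD; apply: ler_bern_expect => // U.
  rewrite -!natrD ler_nat; apply: leq_trans (fS _ _).
  apply: leq_add; apply: fM; last by rewrite subsetI subsetUl subsetUr.
  by rewrite BE setUCA setUC setUS ?subsetUl.
have -> : bern_expect q (fun U => (f (T :|: U :&: (b |: (Z :|: B'))))%:R) =
    q * E (fun U => b |: T :|: U :&: (Z :|: B'))
    + (1 - q) * E (fun U => T :|: U :&: (Z :|: B')).
  rewrite (bern_expect_resample q b) bern_expectD !bern_expectZ.
  congr (_ * _ + _ * _); apply: eq_bern_expect => U; congr (f _)%:R.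
    by rewrite -setUIr setUCA setUA.
  congr (_ :|: _); apply/setP => i; rewrite !in_setI in_setD1 in_setU1.
  by case: eqVneq => [->|//] /=; rewrite (negbTE bY) andbF.
rewrite -/(E (fun U => P U :|: B)) -/(E P); case/andP: q01 => q0 q1.
have q1' : 0 <= 1 - q by rewrite subr_ge0.
have := ler_wpM2l q0 IH1; have := ler_wpM2l q1' IH0.
have := ler_wpM2l (mulr_ge0 q0 q1') sub; lra.
Qed.

(** Each round adds a basis [B] of [~: L]. All of [B] gains as much as [~: L], so its sample closes
    at least the share [q] of the expected gap. *)
Lemma submodular_pool_tower (R : realType) (k t : nat) :
    (forall X, (f X <= k)%N) ->
  exists2 L : {set 'I_n}, (#|L| <= k * t)%N & forall q : R, 0 <= q <= 1 ->
    bern_expect q (fun U => (f (U :&: L :|: ~: L))%:R - (f (U :&: L))%:R)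
      <= (1 - q) ^+ t * k%:R.
Proof.
move=> fk; elim: t => [|t [L cL IHt]].
  exists set0; first by rewrite cards0.
  move=> q q01; rewrite expr0 mul1r -(bern_expect_cst n q k%:R).
  apply: ler_bern_expect => // U; rewrite lerBlDr -natrD ler_nat.
  by rewrite (leq_trans (fk _)) ?leq_addr.
have [B [BL cB fB]] := submodular_basis (~: L).
exists (L :|: B).
  by rewrite mulnS addnC (leq_trans (leq_card_setU _ _)) // leq_add // (leq_trans cB).
move=> q q01.
have LB : [disjoint L & B] by rewrite disjoint_sym disjoints_subset.
have key := bern_expect_submodular set0 q01 LB.
have q1 : 0 <= 1 - q by rewrite subr_ge0; case/andP: q01.
rewrite exprS -mulrA; apply: le_trans (ler_wpM2l q1 (IHt q q01)).
rewrite !bern_expectB; move: key.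
under eq_bern_expect => U do
  rewrite set0U (submodular_span _ BL fB).
under [X in _ + _ * X <= _]eq_bern_expect => U do rewrite set0U.
under [X in _ <= X]eq_bern_expect => U do rewrite set0U.
(* Moving [B] into the pool replaces it by its sample, so the larger set of the gap only shrinks. *)
have : bern_expect q (fun U => (f (U :&: (L :|: B) :|: ~: (L :|: B)))%:R)
   <= bern_expect q (fun U => (f (U :&: L :|: ~: L))%:R) :> R.
  apply: ler_bern_expect => // U; rewrite ler_nat; apply: fM.
  apply/subsetP => i; rewrite !inE; have := subsetP BL i; rewrite !inE.
  by do 3!case: (_ \in _) => //=; move=> /(_ isT).
set x0 := bern_expect q _; set x1 := bern_expect q _; set x2 := bern_expect q _.
set x3 := bern_expect q _.
by move=> H1 H2; lra.
Qed.

Lemma submodular_pool (R : realType) (k t : nat) :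
    (forall X, (f X <= k)%N) ->
  exists2 L : {set 'I_n}, (#|L| <= k * t)%N & forall q : R, 0 <= q <= 1 ->
    bern_expect q (fun U => (f (U :|: ~: L))%:R - (f U)%:R)
      <= (1 - q) ^+ t.+1 * k%:R.
Proof.
move=> fk; have [L cL HL] := submodular_pool_tower R t fk.
exists L => // q q01.
have q1 : 0 <= 1 - q by rewrite subr_ge0; case/andP: q01.
rewrite exprS -mulrA; apply: le_trans (ler_wpM2l q1 (HL q q01)).
(* Sampling [~: L] itself yields one more factor [1 - q] without enlarging [L]. *)
have disj : [disjoint L & ~: L] by rewrite disjoints_subset setCK.
have := bern_expect_submodular set0 q01 disj.
rewrite !bern_expectB setUCr.
under eq_bern_expect => U do rewrite set0U.
under [X in _ + _ * X <= _]eq_bern_expect => U do rewrite set0U.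
under [X in _ <= X]eq_bern_expect => U do rewrite set0U setIT.
have -> : bern_expect q (fun U => (f (U :|: ~: L))%:R : R) =
    bern_expect q (fun U => (f (U :&: L :|: ~: L))%:R).
  by apply: eq_bern_expect => U; rewrite setUIl setUCr setIT.
set x0 := bern_expect q _; set x1 := bern_expect q _; set x2 := bern_expect q _.
by move=> H1; lra.
Qed.

End Submodular.

(** * Total variation and uniform laws *)

Section FiniteDistributions.
Variables (R : realType) (T : finType).
Implicit Types P Q : fdist R T.

Lemma tv_dist_le1 P Q : tv_dist P Q <= 1.
Proof.
have : \sum_x `|P x - Q x| <= \sum_x (P x + Q x).
  apply: ler_sum => x _; apply: le_trans (ler_normB _ _) _.
  by rewrite !ger0_norm ?pmf_ge0.
by rewrite big_split /= !pmf_sum1 /tv_dist; lra.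
Qed.

Lemma tv_dist_eq0 P Q : P =1 Q -> tv_dist P Q = 0.
Proof.
by move=> PQ; rewrite /tv_dist big1 ?mulr0 // => x _; rewrite PQ subrr normr0.
Qed.

(** Total mass [1] forces [V] to be nonempty and fixes the common value, so no probability has to be
    computed. *)
Lemma fdist_uniform_unique (V : pred T) a P Q :
  (forall x, ~~ V x -> P x = 0 /\ Q x = 0) ->
  (forall x, V x -> P x = P a /\ Q x = Q a) -> P =1 Q.
Proof.
move=> PQ0 PQa.
have sumV (S : fdist R T) : (forall x, ~~ V x -> S x = 0) ->
    (forall x, V x -> S x = S a) -> #|V|%:R * S a = 1.
  move=> S0 Sa; rewrite -[RHS](pmf_sum1 S) (bigID V) /= addrC big1 // add0r.
  by rewrite (eq_bigr (fun=> S a)) // sumr_const mulr_natl.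
have sP := sumV P (fun x Vx => (PQ0 x Vx).1) (fun x Vx => (PQa x Vx).1).
have sQ := sumV Q (fun x Vx => (PQ0 x Vx).2) (fun x Vx => (PQa x Vx).2).
have V0 : #|V|%:R != 0 :> R.
  by apply: contra_eq_neq sP => ->; rewrite mul0r eq_sym oner_eq0.
have PQ : P a = Q a by apply: (mulfI V0); rewrite sP sQ.
move=> x; case: (boolP (V x)) => Vx.
  by have [-> ->] := PQa x Vx.
by have [-> ->] := PQ0 x Vx.
Qed.

End FiniteDistributions.

(** * Column spans and their ranks *)

Section ColumnSpan.
Variables (F : fieldType) (k n : nat) (A : 'M[F]_(k, n)).
Implicit Types X Y : {set 'I_n}.

(* Columns of [A] become rows because the [%MS] operations act on row spaces. *)
Definition colspan X : 'M[F]_(n, k) := \matrix_(i, j) (A j i *+ (i \in X)).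

Definition colrank X : nat := \rank (colspan X).

Lemma row_colspan i X :
  row i (colspan X) = if i \in X then (col i A)^T else 0.
Proof. by apply/rowP => j; case: ifP => iX; rewrite !mxE iX. Qed.

Lemma colspanS X Y : X \subset Y -> (colspan X <= colspan Y)%MS.
Proof.
move=> XY; apply/row_subP => i; rewrite row_colspan; case: ifP => iX.
  by rewrite (submx_trans _ (row_sub i _)) // row_colspan (subsetP XY).
exact: sub0mx.
Qed.

Lemma colspanU X Y : (colspan (X :|: Y) <= colspan X + colspan Y)%MS.
Proof.
apply/row_subP => i; rewrite row_colspan inE.
case: (boolP (i \in X)) => iX /=.
  apply: submx_trans (addsmxSl _ _); apply: submx_trans (row_sub i _).
  by rewrite row_colspan iX.
case: (boolP (i \in Y)) => iY; last exact: sub0mx.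
apply: submx_trans (addsmxSr _ _); apply: submx_trans (row_sub i _).
by rewrite row_colspan iY.
Qed.

Lemma colrank_monotone X Y : X \subset Y -> (colrank X <= colrank Y)%N.
Proof. by move=> XY; rewrite mxrankS ?colspanS. Qed.

(** The dimension formula for sums and intersections of subspaces; columns in [X :&: Y] may span
    only part of the intersection. *)
Lemma colrank_submodular X Y :
  (colrank (X :|: Y) + colrank (X :&: Y) <= colrank X + colrank Y)%N.
Proof.
rewrite /colrank -(mxrank_sum_cap (colspan X)) leq_add // mxrankS ?colspanU //.
by rewrite sub_capmx !colspanS ?subsetIl ?subsetIr.
Qed.

Lemma colrank_le X : (colrank X <= k)%N.
Proof. exact: rank_leq_col. Qed.

Lemma colspan_mulmx (u : 'rV_n) X :
  u *m colspan X = (A *m \col_i (u 0 i *+ (i \in X)))^T.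
Proof.
apply/rowP => j; rewrite !mxE; apply: eq_bigr => i _; rewrite !mxE.
by rewrite mulrnAr mulrnAr mulrC.
Qed.

End ColumnSpan.

(** * The sketch of a uniform query vector *)

Section UniformSketch.
Variables (R : realType) (p k n : nat) (A : 'M['F_p]_(k, n)).
Implicit Types M W X : {set 'I_n}.

Let unif_law X (i : 'I_n) : fdist R 'F_p :=
  if i \in X then unif_dist (0 : 'F_p) else dirac_dist (0 : 'F_p).

Lemma sketch_unifE M W y :
  sketch_dist A (unif_aux R p n) M W y =
  \sum_(f : {ffun 'I_n -> 'F_p} | A *m (\col_i f i) == y)
    \prod_i unif_law (M :|: W) i (f i).
Proof.
rewrite /= [RHS](partition_big (fun f : {ffun 'I_n -> 'F_p} => \col_i f i)
  (fun v => A *m v == y)) //=.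
apply: eq_bigr => v /eqP Av; apply: eq_bigl => f.
by case: eqP => [->|]; rewrite ?Av ?eqxx ?andbF.
Qed.

(** A family of nonzero probability vanishes off the query set, so its sketch lies in the span. *)
Lemma sketch_unif_out M W y : ~~ (y^T <= colspan A (M :|: W))%MS ->
  sketch_dist A (unif_aux R p n) M W y = 0.
Proof.
move=> yX; rewrite sketch_unifE big1 // => f /eqP Af.
case: (boolP [exists i, unif_law (M :|: W) i (f i) == 0]) => [/existsP[i fi]|].
  by apply/eqP/prodf_eq0; exists i.
move=> /existsPn f0; case/negP: yX.
have {}f0 i : i \notin M :|: W -> f i = 0.
  move=> iX; have := f0 i; rewrite /= /unif_law (negbTE iX) /= pnatr_eq0 eqb0 negbK.
  by move/eqP.
suff -> : y^T = (\row_i f i) *m colspan A (M :|: W) by exact: submxMl.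
rewrite colspan_mulmx -Af; congr (A *m _)^T; apply/colP => i; rewrite !mxE.
by case: (boolP (i \in _)) => // /f0 ->.
Qed.

(** Translation by a vector [w] supported on the query set with sketch [y] preserves the law and
    carries the fibre over [0] to that over [y]. *)
Lemma sketch_unif_in M W y : (y^T <= colspan A (M :|: W))%MS ->
  sketch_dist A (unif_aux R p n) M W y = sketch_dist A (unif_aux R p n) M W 0.
Proof.
case/submxP => u yu; rewrite !sketch_unifE.
pose w : {ffun 'I_n -> 'F_p} := [ffun i => u 0 i *+ (i \in M :|: W)].
have Aw : A *m \col_i w i = y.
  apply: trmx_inj; rewrite yu colspan_mulmx; congr (A *m _)^T.
  by apply/colP => i; rewrite !mxE ffunE.
have ADw (f : {ffun 'I_n -> 'F_p}) : A *m (\col_i (f + w) i) = A *m (\col_i f i) + y.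
  rewrite -Aw -mulmxDr; congr (A *m _).
  by apply/colP => i; rewrite !mxE ffunE.
rewrite (reindex_inj (addIr w)) /=; apply: eq_big => f.
  by rewrite ADw eq_sym -subr_eq subrr eq_sym.
move=> _; apply: eq_bigr => i _; rewrite /unif_law !ffunE.
by case: ifP => //= _; rewrite addr0.
Qed.

Lemma sketch_unif_span M W M' W' :
    M :|: W \subset M' :|: W' ->
    colrank A (M :|: W) = colrank A (M' :|: W') ->
  sketch_dist A (unif_aux R p n) M W =1 sketch_dist A (unif_aux R p n) M' W'.
Proof.
move=> sub rk.
have E : (colspan A (M :|: W) == colspan A (M' :|: W'))%MS.
  by rewrite -(mxrank_leqif_eq (colspanS A sub)).2; apply/eqP.
apply: (fdist_uniform_unique (V := fun y => (y^T <= colspan A (M :|: W))%MS)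
  (a := 0)) => y yX; split.
- exact: sketch_unif_out.
- by apply: sketch_unif_out; rewrite -(eqmxP E).
- exact: sketch_unif_in.
- by apply: sketch_unif_in; rewrite -(eqmxP E).
Qed.

End UniformSketch.

(** * From expected codimension to determining pools *)

Lemma unif_determining_pool (R : realType) (p k n t : nat)
    (A : 'M['F_p]_(k, n)) (qmin qmax delta : R) :
    0 <= qmin -> qmax <= 1 -> (1 - qmin) ^+ t.+1 * k%:R <= delta ->
  exists2 L : {set 'I_n},
    determining_pool A (unif_aux R p n) qmin qmax delta L & (#|L| <= k * t)%N.
Proof.
move=> qmin0 qmax1 small; have rM := @colrank_monotone _ _ _ A.
have [L cL HL] := submodular_pool rM (@colrank_submodular _ _ _ A) R t
  (@colrank_le _ _ _ A).
exists L => //.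
(* The reference law treats all of [~: L] as queried, so it needs [U] only inside [L]. *)
exists (fun M W => sketch_dist A (unif_aux R p n) M (W :|: ~: L)) => M q ML /andP[qq qQ].
have q01 : 0 <= q <= 1 by rewrite (le_trans qmin0 qq) (le_trans qQ qmax1).
apply: le_trans small; apply: le_trans (le_trans (HL q q01) _); last first.
  apply: ler_wpM2r => //; apply: lerXn2r; rewrite ?nnegrE; lra.
apply: ler_bern_expect => // U.
have MU : M :|: (U :\: M) = M :|: U.
  by apply/setP => i; rewrite !inE; case: (i \in M).
have MUL : M :|: (U :&: (L :\: M) :|: ~: L) = M :|: (U :|: ~: L).
  by apply/setP => i; rewrite !inE; do 3!case: (_ \in _).
(* The rank gap is an integer: at [0] the laws coincide, and otherwise it is at least [1], which
   bounds any total variation distance. *)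
have := rM _ _ (subsetUl U (~: L)).
rewrite leq_eqVlt => /predU1P[rU | lt_r].
  rewrite rU subrr tv_dist_eq0 //; apply: sketch_unif_span.
    by rewrite MU MUL setUS ?subsetUl.
  rewrite MU MUL.
  exact: (submodular_span rM (@colrank_submodular _ _ _ A) M (subsetUl _ _) rU).
apply: le_trans (tv_dist_le1 _ _) _.
by rewrite lerBrDr -[1]/(1%:R) -natrD ler_nat add1n.
Qed.

Theorem mainTheorem8 (R : realType) (qmin : R) (hqmin : 0 < qmin) :
  exists2 C : R, 0 < C &
    forall (qmax delta : R) (p k n : nat) (A : 'M['F_p]_(k, n)),
      qmin <= qmax -> qmax < 1 -> 0 < delta -> delta < 1 -> prime p ->
      exists2 L : {set 'I_n},
        determining_pool A (unif_aux R p n) qmin qmax delta L &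
        #|L|%:R <= C * (k%:R * ln (k%:R / delta)).
Proof.
(* No [qmax] is admissible once [qmin >= 1]; the logarithm below needs [1 - qmin > 0]. *)
have [q1|q1] := ltP qmin 1; last first.
  exists 1 => // qmax delta p k n A qq qmax1.
  by have := le_lt_trans (le_trans q1 qq) qmax1; rewrite ltxx.
(* The decay rate: [(1 - qmin) ^+ t.+1 * k%:R <= delta] holds for [k > 0] once [t.+1] reaches
   [ln (k%:R / delta) / c]. *)
pose c := - ln (1 - qmin).
have c0 : 0 < c by rewrite oppr_gt0 ln_lt0 //; lra.
exists c^-1; first by rewrite invr_gt0.
move=> qmax delta p k n A _ qmax1 d0 d1 _.
have ln0 : 0 <= ln (k%:R / delta).
  (* For [k = 0] this relies on the convention that [ln 0] is [0]. *)
  case: k A => [|k] _; first by rewrite mul0r ln0.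
  apply: ln_ge0; rewrite ler_pdivlMr // mul1r (le_trans (ltW d1)) //.
  by rewrite ler1n.
(* Rounding down, which the extra factor for [~: L] pays for, is essential: for
   [k = 1] and [delta] close to [1] the size bound forces [L] to be empty. *)
pose t := Num.trunc (ln (k%:R / delta) / c).
have t0 : 0 <= ln (k%:R / delta) / c by rewrite divr_ge0 // ltW.
have /andP[t_le t_lt] := truncn_itv t0; rewrite -/t in t_le t_lt.
have small : (1 - qmin) ^+ t.+1 * k%:R <= delta.
  have [k0|k_gt0] := posnP k; first by rewrite k0 mulr0 ltW.
  have kR : 0 < k%:R :> R by rewrite ltr0n.
  have pw : 0 < (1 - qmin) ^+ t.+1 by rewrite exprn_gt0 //; lra.
  rewrite -ler_pdivlMr // -ler_ln ?posrE ?divr_gt0 // lnXn; last lra.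
  have -> : delta / k%:R = (k%:R / delta)^-1 by rewrite invf_div.
  rewrite lnV ?posrE ?divr_gt0 // lerNr -mulNrn -/c.
  by rewrite -[c *+ _]mulr_natl -ler_pdivrMr // ltW.
have [L HL cL] := unif_determining_pool A (ltW hqmin) (ltW qmax1) small.
exists L => //.
apply: le_trans (_ : k%:R * t%:R <= _); first by rewrite -natrM ler_nat.
rewrite mulrCA ler_wpM2l //.
by rewrite mulrC.
Qed.
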